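(* Let $q\in(0,1)$, let $n\ge 1$ be an integer, let $x_k>0$ for $1\le k\le n$, and let $p_k\ge 0$ for $1\le k\le n$ with $\sum_{k=1}^n p_k=1$. Then $$\frac{\left(\frac{1-q^{\sum_{k=1}^n p_kx_k}}{1-q}\right)^{\sum_{k=1}^n p_kx_k}}{\prod_{k=1}^n\left(\frac{1-q^{x_k}}{1-q}\right)^{p_kx_k}}\exp\left(\frac{\mathrm{Li}_2\left(1-q^{\sum_{k=1}^n p_kx_k}\right)-\sum_{k=1}^n p_k\,\mathrm{Li}_2(1-q^{x_k})}{\log q}\right)\le\frac{\Gamma_q\left(\sum_{k=1}^n p_kx_k+1\right)}{\prod_{k=1}^n\left[\Gamma_q(x_k+1)\right]^{p_k}}$$ and $$\frac{\Gamma_q\left(\sum_{k=1}^n p_kx_k+1\right)}{\prod_{k=1}^n\left[\Gamma_q(x_k+1)\right]^{p_k}}\le\frac{\left(\frac{1-q^{\sum_{k=1}^n p_kx_k}}{1-q}\right)^{\sum_{k=1}^n p_kx_k+1/2}}{\prod_{k=1}^n\left(\frac{1-q^{x_k}}{1-q}\right)^{p_k(x_k+1/2)}}\exp\left(\frac{\mathrm{Li}_2\left(1-q^{\sum_{k=1}^n p_kx_k}\right)-\sum_{k=1}^n p_k\,\mathrm{Li}_2(1-q^{x_k})}{\log q}\right).$$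
   Context: For $0<q<1$ and $x>0$, the $q$-gamma function is $\Gamma_q(x)=(1-q)^{1-x}\prod_{j=0}^{\infty}\frac{1-q^{j+1}}{1-q^{j+x}}$. The dilogarithm is $\mathrm{Li}_2(z)=-\int_0^z\frac{\log(1-t)}{t}\,dt$ for $0<z<1$. *)

(* Defs.v *)
From HB Require Import structures.
From mathcomp Require Import all_boot all_order all_algebra.
From mathcomp Require Import all_classical all_reals all_analysis.

Set Implicit Arguments.
Unset Strict Implicit.
Unset Printing Implicit Defensive.

Import Order.TTheory GRing.Theory Num.Theory.
Import numFieldNormedType.Exports.

Local Open Scope classical_set_scope.
Local Open Scope ring_scope.

(* Meant for 0 < q < 1 and 0 < x, where the partial products converge; [lim]
   returns an arbitrary point on a divergent sequence. *)
Definition qGamma (R : realType) (q x : R) : R :=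
  (1 - q) `^ (1 - x) *
  lim ((fun N : nat =>
          \prod_(0 <= j < N) ((1 - q ^+ j.+1) / (1 - q `^ (j%:R + x))))
       @ \oo).

(* Meant for 0 < z < 1. The integrand has a removable singularity at t = 0,
   where its value under the convention 0^-1 = 0 is 0; a single point does not
   affect the Lebesgue integral. *)
Definition Li2 (R : realType) (z : R) : R :=
  - \int[@lebesgue_measure R]_(t in `[0, z]) (ln (1 - t) / t).

(* Main.v *)
Require Import Defs.
From HB Require Import structures.
From mathcomp Require Import all_boot all_order all_algebra.
From mathcomp Require Import all_classical all_reals all_analysis.
From mathcomp Require Import measurable_realfun ring lra.

(** Write [h y = ln (1 - q^y)] and let [H] be its antiderivative
    [H y = y h(y) + Li2 (1 - q^y) / ln q]; the derivative of [Li2] is exactly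
    what cancels the term [y h'(y)].  Call the Jensen gap of [f] the number
    [f (sum p_k x_k) - sum p_k f (x_k)].  It is linear in [f] and kills affine
    functions, so after taking logarithms all powers of [1 - q] disappear and
    the two inequalities become

      gap H <= gap (ln qGamma (. + 1)) <= gap H + (1/2) gap h.

    Up to an affine function, [ln qGamma (y + 1)] is the limit of
    [- sum_(1 <= j <= N) h (y + j)], and [H (y + N) - H y] telescopes into
    [sum_(j < N) (H (y + j + 1) - H (y + j))].  Comparing the two sums term by
    term compares the integral of [h] over a unit interval with a quadrature
    rule:
    - the right-endpoint error [H (y + 1) - H y - h (y + 1)] is concave in [y];
    - the trapezoid error [H (y + 1) - H y - (h y + h (y + 1)) / 2] is convex.
    These are the lower and the upper bound ([jensen_gap_right_endpoint] and
    [jensen_gap_trapezoid]); the trapezoid rule contributes the extra [h / 2],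
    because its endpoint halves telescope.  With [z = q^y], both second
    derivatives are rational in [z] and [q] except for the factor [ln q], and
    their signs follow from
    [2 (1 - q) / (1 + q) <= - ln q <= (1 - q) / q]
    ([dqlog_increment_le], [dqlog_increment_ge]).

    The remaining boundary terms [gap (H (. + N))] and [gap (h (. + N))] vanish
    in the limit because [h] decays geometrically; the same decay makes the
    infinite product converge to a nonzero limit. *)

Set Implicit Arguments.
Unset Strict Implicit.
Unset Printing Implicit Defensive.

Import Order.TTheory GRing.Theory Num.Theory.
Import numFieldNormedType.Exports.

Local Open Scope classical_set_scope.
Local Open Scope ring_scope.

(** * Calculus on the positive half-line *)

Lemma MVT_pos {R : realType} (f f' : R -> R) (a b : R) :
  (forall x : R, 0 < x -> is_derive x 1 f (f' x)) -> 0 < a -> a <= b ->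
  exists2 c, a <= c <= b & f b - f a = f' c * (b - a).
Proof.
move=> df a0 ab.
have [||c] := @MVT_segment R f f' a b ab.
- by move=> x; rewrite in_itv/= => /andP[ax _]; apply: df; apply: lt_trans ax.
- apply: derivable_within_continuous => x; rewrite in_itv/= => /andP[ax _].
  by apply: ex_derive; apply: df; apply: lt_le_trans ax.
- by rewrite in_itv/=; exists c.
Qed.

Lemma nondecreasing_derive {R : realType} (f f' : R -> R) (a b : R) :
  (forall x : R, 0 < x -> is_derive x 1 f (f' x)) ->
  (forall x : R, 0 < x -> 0 <= f' x) ->
  0 < a -> a <= b -> f a <= f b.
Proof.
move=> df f'0 a0 ab; have [c /andP[ac cb] e] := MVT_pos df a0 ab.
rewrite -subr_ge0 e mulr_ge0 ?subr_ge0// f'0//; exact: lt_le_trans ac.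
Qed.

Lemma tangent_le {R : realType} (f f' : R -> R) (a b : R) :
  (forall x : R, 0 < x -> is_derive x 1 f (f' x)) ->
  (forall x y : R, 0 < x -> x <= y -> f' x <= f' y) ->
  0 < a -> 0 < b -> f a + f' a * (b - a) <= f b.
Proof.
move=> df f'nd a0 b0; case: (leP a b) => [ab|/ltW ba].
- have [c /andP[ac cb] e] := MVT_pos df a0 ab.
  by rewrite -lerBrDl e ler_wpM2r ?subr_ge0// f'nd.
- have [c /andP[bc ca] e] := MVT_pos df b0 ba.
  have c0 : 0 < c by exact: lt_le_trans bc.
  have : f' c * (a - b) <= f' a * (a - b) by rewrite ler_wpM2r ?subr_ge0// f'nd.
  by rewrite -e; lra.
Qed.

Lemma is_derive_add_arg {R : realType} (f : R -> R) (c y d : R) :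
  is_derive (y + c) 1 f d -> is_derive y 1 (fun t => f (t + c)) d.
Proof.
move=> df; have -> : (fun t => f (t + c)) = f \o (id + cst c) by [].
by apply: is_derive_eq; rewrite addr0 mulr1.
Qed.

(** * Jensen gaps *)

Definition jensen_gap {R : realType} {n : nat} (p x : 'I_n -> R) (f : R -> R) : R :=
  f (\sum_(k < n) p k * x k) - \sum_(k < n) p k * f (x k).

Section jensen_gap.
Context {R : realType} {n : nat} (p x : 'I_n -> R).
Context (x_gt0 : forall k, 0 < x k) (p_ge0 : forall k, 0 <= p k)
        (p_sum1 : \sum_(k < n) p k = 1).

Local Notation s := (\sum_(k < n) p k * x k).
Local Notation gap := (jensen_gap p x).

Lemma wmean_gt0 : 0 < s.
Proof.
rewrite lt_neqAle sumr_ge0 ?andbT; last by move=> k _; rewrite mulr_ge0// ltW.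
apply/eqP => /esym/psumr_eq0P s0.
have : \sum_(k < n) p k = 0.
  apply: big1 => k _; apply/eqP.
  have /eqP := s0 (fun k _ => mulr_ge0 (p_ge0 k) (ltW (x_gt0 k))) k isT.
  by rewrite mulf_eq0 (gt_eqF (x_gt0 k)) orbF.
by rewrite p_sum1 => /eqP; rewrite oner_eq0.
Qed.

Lemma jensen_gapD f g : gap (fun y => f y + g y) = gap f + gap g.
Proof.
rewrite /jensen_gap.
have -> : \sum_(k < n) p k * (f (x k) + g (x k)) =
    \sum_(k < n) p k * f (x k) + \sum_(k < n) p k * g (x k).
  by rewrite -big_split; apply: eq_bigr => k _; rewrite mulrDr.
ring.
Qed.

Lemma jensen_gapZ c f : gap (fun y => c * f y) = c * gap f.
Proof.
rewrite /jensen_gap mulrBr mulr_sumr; congr (_ - _).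
by apply: eq_bigr => k _; rewrite mulrCA.
Qed.

Lemma jensen_gapN f : gap (fun y => - f y) = - gap f.
Proof.
rewrite -mulN1r -jensen_gapZ; congr jensen_gap.
by apply/funext => y; rewrite mulN1r.
Qed.

Lemma jensen_gap_affine c d : gap (fun y => c * y + d) = 0.
Proof.
rewrite /jensen_gap.
have -> : \sum_(k < n) p k * (c * x k + d) =
    \sum_(k < n) (c * (p k * x k) + p k * d).
  by apply: eq_bigr => k _; ring.
by rewrite big_split/= -mulr_sumr -mulr_suml p_sum1 mul1r subrr.
Qed.

Lemma jensen_gap_cst c : gap (fun=> c) = 0.
Proof. by rewrite /jensen_gap -mulr_suml p_sum1 mul1r subrr. Qed.

(** Jensen's inequality: the graph of a convex function lies above its tangent
    at the weighted mean [s], and averaging this over the [x k] removes the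
    linear term of the tangent. *)
Lemma jensen_gap_le0 (f f' f'' : R -> R) :
  (forall y : R, 0 < y -> is_derive y 1 f (f' y)) ->
  (forall y : R, 0 < y -> is_derive y 1 f' (f'' y)) ->
  (forall y : R, 0 < y -> 0 <= f'' y) -> gap f <= 0.
Proof.
move=> df df' f''0; rewrite /jensen_gap subr_le0.
have tl k : f s + f' s * (x k - s) <= f (x k).
  apply: tangent_le => //; last exact: wmean_gt0.
  by move=> ? ? ? ?; apply: nondecreasing_derive df' _ _ _.
have : \sum_(k < n) p k * (f s + f' s * (x k - s)) <=
    \sum_(k < n) p k * f (x k).
  by apply: ler_sum => k _; rewrite ler_wpM2l.
suff -> : \sum_(k < n) p k * (f s + f' s * (x k - s)) = f s by [].
transitivity (\sum_(k < n) (p k * (f s - f' s * s) + f' s * (p k * x k))).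
  by apply: eq_bigr => k _; ring.
by rewrite big_split/= -mulr_suml -mulr_sumr p_sum1; ring.
Qed.

Lemma jensen_gap_cvg (u : nat -> R -> R) (l : R -> R) :
  (forall y, 0 < y -> u N y @[N --> \oo] --> l y) ->
  gap (u N) @[N --> \oo] --> gap l.
Proof.
move=> ul; rewrite /jensen_gap; apply: cvgB; first exact/ul/wmean_gt0.
apply: cvg_big => [|k _]; first exact: add_continuous.
by apply: cvgMl_tmp; exact: ul.
Qed.

(** As [p] sums to [1], the gap is a weighted average of the differences
    [u N s - u N (x k)].  So it suffices that differences of two values vanish,
    and [u N] itself need not be shown to converge. *)
Lemma jensen_gap_cvg0 (u : nat -> R -> R) :
  (forall y z, 0 < y -> 0 < z -> u N y - u N z @[N --> \oo] --> (0 : R)) ->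
  gap (u N) @[N --> \oo] --> (0 : R).
Proof.
move=> ul.
rewrite (_ : (fun N => gap (u N)) =
    fun N => \sum_(k < n) p k * (u N s - u N (x k))).
  rewrite -[X in _ --> X](_ : \sum_(k < n) p k * 0 = 0); last first.
    by rewrite big1// => k _; rewrite mulr0.
  apply: cvg_big => [|k _]; first exact: add_continuous.
  by apply: cvgMl_tmp; apply: ul => //; exact: wmean_gt0.
apply/funext => N; rewrite /jensen_gap.
transitivity (\sum_(k < n) (p k * u N s - p k * u N (x k))).
  by rewrite sumrB -mulr_suml p_sum1 mul1r.
by apply: eq_bigr => k _; rewrite mulrBr.
Qed.

(** The quotients of the theorem all have this shape, with [f] the logarithm of
    the function under consideration. *)
Lemma expR_jensen_gap (f : R -> R) :
  expR (gap f) = expR (f s) / \prod_(k < n) expR (f (x k)) `^ p k.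
Proof.
rewrite /jensen_gap expRB expR_sum; congr (_ / _).
by apply: eq_bigr => k _; rewrite mulrC expRM.
Qed.
End jensen_gap.

(** * Derivative of the dilogarithm *)

Lemma measurable_ln1B_div {R : realType} (u : R) :
  measurable_fun `]0, u] (fun t : R => ln (1 - t) / t).
Proof.
apply: measurable_funM.
  apply: measurableT_comp => //; apply: measurable_funB => //.
apply: subspace_continuous_measurable_fun => //.
apply: continuous_in_subspaceT => t; rewrite inE/= in_itv/= => /andP[t0 _].
by apply: continuousV; [rewrite gt_eqF|exact: cvg_id].
Qed.

(** The bound [- ln (1 - t) / t <= 1 / (1 - t)] makes the integrand bounded on
    the interval, in spite of the division by [t]. *)
Lemma integrable_ln1B_div {R : realType} (u : R) : 0 < u < 1 ->
  (@lebesgue_measure R).-integrable `]0, u] (EFin \o (fun t => ln (1 - t) / t)).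
Proof.
move=> /andP[u0 u1]; apply: measurable_bounded_integrable => //.
- by rewrite /= lebesgue_measure_itv/= lte_fin u0 -EFinB ltry.
- exact: measurable_ln1B_div.
- exists (1 - u)^-1; split; first by rewrite num_real.
  move=> M uM t /=; rewrite in_itv/= => /andP[t0 tu]; apply: (le_trans _ (ltW uM)).
  have t1 : 0 < 1 - t by rewrite subr_gt0 (le_lt_trans tu).
  rewrite normrM normfV (gtr0_norm t0) ler_pdivrMr// ler0_norm; last first.
    by rewrite ln_le0// gerBl ltW.
  rewrite -lnV ?posrE//.
  have := @le_ln1Dx R ((1 - t)^-1 - 1).
  have -> : 1 + ((1 - t)^-1 - 1) = (1 - t)^-1 by ring.
  move=> /(_ _)/le_trans; apply; first by rewrite ltrBrDr addrC subrr invr_gt0.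
  have -> : (1 - t)^-1 - 1 = (1 - t)^-1 * t by field; rewrite gt_eqF.
  apply: ler_wpM2r; first exact: ltW.
  by rewrite lef_pV2 ?posrE//; lra.
Qed.

(** The integrand jumps to [0] at [t = 0], but the fundamental theorem of
    calculus only asks for continuity at [z]; the endpoint [0] is dropped from
    the interval, which changes no integral. *)
Lemma is_derive_Li2 {R : realType} (z : R) : 0 < z < 1 ->
  is_derive z 1 (@Li2 R) (- (ln (1 - z) / z)).
Proof.
move=> /andP[z0 z1].
pose u := (z + 1) / 2.
have zu : z < u by rewrite /u; lra.
have u1 : u < 1 by rewrite /u; lra.
have [|||d1 d2] := @continuous_FTC1 R (fun t => ln (1 - t) / t) (BRight 0) z u zu
  (integrable_ln1B_div _) _ _.
- by rewrite (lt_trans z0 zu).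
- by [].
- apply: continuousM; last by apply: continuousV; [rewrite gt_eqF|exact: cvg_id].
  apply: (@continuous_comp R R R (fun t => 1 - t) (@ln R)).
    by apply: continuousB; [exact: cst_continuous|exact: cvg_id].
  by apply: continuous_ln; rewrite subr_gt0.
have Li2E : @Li2 R =
    \- (fun x => \int[@lebesgue_measure R]_(t in `]0, x]) (ln (1 - t) / t)).
  apply/funext => x /=; congr (- _).
  rewrite /Rintegral -integral_itv_obnd_cbnd//.
  apply/measurable_EFinP; exact: (@measurable_ln1B_div R x).
rewrite Li2E; apply: is_deriveN; rewrite -d2 derive1E; exact: derivableP.
Qed.

(** * The function ln (1 - q^y), its antiderivative and its derivatives *)

Definition qlog {R : realType} (q y : R) : R := ln (1 - q `^ y).
Definition dqlog {R : realType} (q y : R) : R := - ln q * (q `^ y / (1 - q `^ y)).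
Definition d2qlog {R : realType} (q y : R) : R :=
  - (ln q) ^+ 2 * (q `^ y / (1 - q `^ y) ^+ 2).
Definition qlog_prim {R : realType} (q y : R) : R :=
  y * qlog q y + Li2 (1 - q `^ y) / ln q.

Section qlog.
Context {R : realType} (q : R) (q_gt0 : 0 < q) (q_lt1 : q < 1).

Lemma powR_itv01 (y : R) : 0 < y -> 0 < q `^ y < 1.
Proof.
move=> y0; rewrite powR_gt0//= /powR gt_eqF// expR_lt1.
by rewrite pmulr_rlt0// ln_lt0// q_gt0.
Qed.

Lemma is_derive_qpow (y : R) : is_derive y 1 (powR q) (q `^ y * ln q).
Proof.
have -> : powR q = expR \o (fun z => z * ln q).
  by apply/funext => z; rewrite /powR gt_eqF.
by apply: is_derive_eq; rewrite /= scaler0 add0r [_%:A]mulr1.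
Qed.

Lemma is_derive_qlog (y : R) : 0 < y -> is_derive y 1 (qlog q) (dqlog q y).
Proof.
move=> /powR_itv01/andP[z0 z1].
have qd := is_derive_qpow y.
have ? : is_derive (1 - q `^ y) 1 (@ln R) (1 - q `^ y)^-1.
  by apply: is_derive1_ln; rewrite subr_gt0.
have -> : qlog q = @ln R \o (cst 1 - powR q) by [].
apply: is_derive_eq; rewrite /dqlog; ring.
Qed.

Lemma is_derive_dqlog (y : R) : 0 < y -> is_derive y 1 (dqlog q) (d2qlog q y).
Proof.
move=> /powR_itv01/andP[z0 z1].
have qd := is_derive_qpow y.
have z1' : 1 - q `^ y != 0 by rewrite subr_eq0 gt_eqF.
have ? := @is_deriveV R (cst 1 - powR q) y _ 1 z1' _.
have -> : dqlog q = (- ln q) *: (powR q * (fun y => (1 - powR q y)^-1)) by [].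
by apply: is_derive_eq; rewrite /d2qlog /GRing.scale/=; field.
Qed.

(** The two occurrences of [y q^y ln q / (1 - q^y)], one from the product rule
    and one from [Li2], cancel. *)
Lemma is_derive_qlog_prim (y : R) : 0 < y -> is_derive y 1 (qlog_prim q) (qlog q y).
Proof.
move=> y0; have /andP[z0 z1] := powR_itv01 y0.
have qd := is_derive_qpow y.
have hd := is_derive_qlog y0.
have Ld : is_derive (1 - q `^ y) 1 (@Li2 R)
    (- (y * ln q / (1 - q `^ y))).
  have := @is_derive_Li2 R (1 - q `^ y).
  by rewrite subKr ln_powR; apply; apply/andP; split; lra.
have -> : qlog_prim q = id * qlog q + (ln q)^-1 *: (@Li2 R \o (cst 1 - powR q)).
  by apply/funext => z; rewrite /qlog_prim [Li2 _ / _]mulrC.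
have lq0 : ln q != 0 by rewrite lt_eqF// ln_lt0// q_gt0.
have z1' : 1 - q `^ y != 0 by rewrite subr_eq0 gt_eqF.
have zd := is_deriveB (is_derive_cst (1 : R) y (1 : R)) qd.
have := is_deriveD (is_deriveM (is_derive_id y (1 : R)) hd)
  (is_deriveZ (ln q)^-1 (is_derive1_comp (f := @Li2 R) (g := cst 1 - powR q) Ld zd)).
move=> /is_derive_eq; apply; rewrite /dqlog /GRing.scale/=; field.
by rewrite z1' lq0.
Qed.

Lemma ln_q_le : - ln q <= (1 - q) / q.
Proof.
have := @le_ln1Dx R ((1 - q) / q).
have -> : 1 + (1 - q) / q = q^-1 by field; rewrite gt_eqF.
rewrite lnV ?posrE//; apply.
by rewrite (lt_trans (ltrN10 R))// divr_gt0// subr_gt0.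
Qed.

(** The function [ln t + 4 / (1 + t)] has the nonnegative derivative
    [(1 - t)^2 / (t (1 + t)^2)]; the bound compares its values at [q] and [1]. *)
Lemma ln_q_ge : 2 * (1 - q) / (1 + q) <= - ln q.
Proof.
pose f := @ln R + 4%:R *: (fun t : R => (1 + t)^-1).
pose f' (t : R) := (1 - t) ^+ 2 / (t * (1 + t) ^+ 2).
have df (t : R) : 0 < t -> is_derive t 1 f (f' t).
  move=> t0; have t1 : 1 + t != 0 by rewrite gt_eqF// addr_gt0.
  have vd := is_deriveV (f := cst 1 + id) t1
    (is_deriveD (is_derive_cst (1 : R) t (1 : R)) (is_derive_id t (1 : R))).
  have := is_deriveD (is_derive1_ln t0) (is_deriveZ 4%:R vd).
  move=> /is_derive_eq; apply; rewrite /f' /GRing.scale/= !fctE; field.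
  by rewrite t1 gt_eqF.
have f'0 (t : R) : 0 < t -> 0 <= f' t.
  move=> t0; rewrite /f' divr_ge0 ?sqr_ge0// mulr_ge0 ?sqr_ge0//; exact: ltW.
have := nondecreasing_derive df f'0 q_gt0 (ltW q_lt1).
have -> : f 1 = 2 by rewrite /f/= !fctE/= ln1 /GRing.scale/=; field.
have -> : f q = ln q + 4 / (1 + q) by [].
have -> : 2 * (1 - q) / (1 + q) = 4 / (1 + q) - 2.
  by field; rewrite gt_eqF// addr_gt0.
lra.
Qed.

(** Concavity of the right-endpoint error.  Writing [L = - ln q] and [z = q^y],
    the difference of the two sides is a positive factor times a sum of terms
    which are nonnegative because [L q <= 1 - q]. *)
Lemma dqlog_increment_le (y : R) : 0 < y ->
  dqlog q (y + 1) - dqlog q y <= d2qlog q (y + 1).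
Proof.
move=> y0; have /andP[z0 z1] := powR_itv01 y0.
rewrite /dqlog /d2qlog powRD ?(gt_eqF q_gt0) ?implybT// powRr1 ?(ltW q_gt0)//.
have L0 : 0 < - ln q by rewrite oppr_gt0 ln_lt0// q_gt0.
have := ln_q_le.
rewrite ler_pdivlMr// -(sqrrN (ln q)).
set z := q `^ y in z0 z1 *; set L := - ln q in L0 *.
move=> Lq.
have zq1 : 0 < 1 - z * q.
  by rewrite subr_gt0; apply: lt_trans q_lt1; rewrite gtr_pMl.
have z1' : 0 < 1 - z by rewrite subr_gt0.
rewrite -subr_ge0.
have -> : - L ^+ 2 * (z * q / (1 - z * q) ^+ 2) -
  (L * (z * q / (1 - z * q)) - L * (z / (1 - z))) =
  L * z * (((1 - q) - L * q) * (1 - z * q) + L * q * (z * (1 - q))) /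
   ((1 - z * q) ^+ 2 * (1 - z)).
  by field; rewrite !gt_eqF.
rewrite divr_ge0//; last by rewrite mulr_ge0// ?sqr_ge0// ltW.
rewrite mulr_ge0//; first by rewrite mulr_ge0// ltW.
have := (ltW zq1, ltW z0, ltW q_gt0, ltW L0, ltW q_lt1) => -[[[[? ?] ?] ?] ?].
by apply: addr_ge0; rewrite !mulr_ge0// subr_ge0.
Qed.

(** Convexity of the trapezoid error.  Here the decomposition into nonnegative
    terms needs the sharper bound [2 (1 - q) <= L (1 + q)], and its remainder is
    a multiple of [(1 - q)^2]. *)
Lemma dqlog_increment_ge (y : R) : 0 < y ->
  (d2qlog q y + d2qlog q (y + 1)) / 2 <= dqlog q (y + 1) - dqlog q y.
Proof.
move=> y0; have /andP[z0 z1] := powR_itv01 y0.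
rewrite /dqlog /d2qlog powRD ?(gt_eqF q_gt0) ?implybT// powRr1 ?(ltW q_gt0)//.
have L0 : 0 < - ln q by rewrite oppr_gt0 ln_lt0// q_gt0.
have := ln_q_ge.
rewrite ler_pdivrMr ?addr_gt0// -(sqrrN (ln q)).
set z := q `^ y in z0 z1 *; set L := - ln q in L0 *.
move=> Lq.
have zq1 : 0 < 1 - z * q.
  by rewrite subr_gt0; apply: lt_trans q_lt1; rewrite gtr_pMl.
have z1' : 0 < 1 - z by rewrite subr_gt0.
rewrite -subr_ge0.
have -> : L * (z * q / (1 - z * q)) - L * (z / (1 - z)) -
  (- L ^+ 2 * (z / (1 - z) ^+ 2) + - L ^+ 2 * (z * q / (1 - z * q) ^+ 2)) / 2 =
  L * z * ((L * (1 + q) - 2 * (1 - q)) * ((1 - z) * (1 - z * q)) +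
           L * (z * (1 - q) ^+ 2)) /
   (2 * (1 - z * q) ^+ 2 * (1 - z) ^+ 2).
  by field; rewrite !gt_eqF.
rewrite divr_ge0//; last by rewrite !mulr_ge0// ?sqr_ge0// ltW.
rewrite mulr_ge0//; first by rewrite mulr_ge0// ltW.
have := (ltW zq1, ltW z1', ltW z0, ltW L0) => -[[[? ?] ?] ?].
apply: addr_ge0; last by rewrite mulr_ge0// mulr_ge0// sqr_ge0.
apply: mulr_ge0; last exact: mulr_ge0.
by rewrite subr_ge0.
Qed.
End qlog.

(** * Decay of ln (1 - q^y) *)

Section qlog_bounds.
Context {R : realType} (q : R) (q_gt0 : 0 < q) (q_lt1 : q < 1).

Lemma qlog_le0 (y : R) : 0 < y -> qlog q y <= 0.
Proof.
by move=> /(powR_itv01 q_gt0 q_lt1)/andP[z0 z1]; rewrite ln_le0// gerBl ltW.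
Qed.

Lemma qlog_nondecreasing (y z : R) : 0 < y -> y <= z -> qlog q y <= qlog q z.
Proof.
apply: nondecreasing_derive; first exact: is_derive_qlog.
move=> t /(powR_itv01 q_gt0 q_lt1)/andP[z0 z1].
rewrite /dqlog mulr_ge0//; first by rewrite oppr_ge0 ln_le0// ltW.
by rewrite divr_ge0 ?subr_ge0// ltW.
Qed.

Lemma qlog_ge (y : R) : 0 < y -> - (q `^ y / (1 - q `^ y)) <= qlog q y.
Proof.
move=> /(powR_itv01 q_gt0 q_lt1)/andP[z0 z1].
have z1' : 0 < 1 - q `^ y by rewrite subr_gt0.
have := @le_ln1Dx R (q `^ y / (1 - q `^ y)).
have -> : 1 + q `^ y / (1 - q `^ y) = (1 - q `^ y)^-1 by field; rewrite gt_eqF.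
rewrite lnV ?posrE// lerNl; apply.
by rewrite (lt_trans (ltrN10 R))// divr_gt0.
Qed.

(** Geometric decay: it controls both the infinite product and the boundary
    terms of the telescoping sums. *)
Lemma qlog_ge_geometric (N : nat) (y : R) : (0 < N)%N -> N%:R <= y ->
  - (q ^+ N / (1 - q)) <= qlog q y.
Proof.
move=> N0 Ny; have N0' : 0 < N%:R :> R by rewrite ltr0n.
apply: le_trans (qlog_nondecreasing N0' Ny).
apply: le_trans (qlog_ge N0'); rewrite lerN2 powR_mulrn ?(ltW q_gt0)//.
have q1 : 0 < 1 - q by rewrite subr_gt0.
have qN1 : q ^+ N <= q by rewrite -{2}(expr1 q) ler_wiXn2l// ltW.
apply: ler_pM => //; first by rewrite exprn_ge0// ltW.
  by rewrite invr_ge0 subr_ge0; lra.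
by rewrite lef_pV2 ?posrE; lra.
Qed.

Lemma cvg_geometric_div : q ^+ N / (1 - q) @[N --> \oo] --> (0 : R).
Proof.
have -> : (fun N => q ^+ N / (1 - q)) = geometric (1 - q)^-1 q.
  by apply/funext => N /=; rewrite mulrC.
by apply: cvg_geometric; rewrite gtr0_norm.
Qed.

Lemma cvg_qlog_shift (y : R) : 0 < y -> qlog q (y + N%:R) @[N --> \oo] --> (0 : R).
Proof.
move=> y0.
apply: (@squeeze_cvgr _ _ _ _ (fun N => - (q ^+ N / (1 - q))) (fun=> 0)).
- near=> N.
  rewrite qlog_le0 ?ltr_wpDr// qlog_ge_geometric ?lerDr ?ltW//.
  by near: N; exact: nbhs_infty_gt.
- rewrite -[X in _ --> X]oppr0; apply: cvgN; exact: cvg_geometric_div.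
- exact: cvg_cst.
Unshelve. all: by end_near. Qed.

(** By the mean value theorem the difference is [(y - z) * qlog q c] for some
    [c >= N], so no limit of the dilogarithm at [1] is needed. *)
Lemma cvg_qlog_prim_shift (y z : R) : 0 < y -> 0 < z ->
  qlog_prim q (y + N%:R) - qlog_prim q (z + N%:R) @[N --> \oo] --> (0 : R).
Proof.
move=> y0 z0.
wlog yz : y z y0 z0 / y <= z.
  move=> W; case: (leP y z) => [|/ltW zy]; first exact: W.
  rewrite -[X in _ --> X]oppr0.
  rewrite (_ : (fun N => _) =
    fun N => - (qlog_prim q (z + N%:R) - qlog_prim q (y + N%:R))); last first.
    by apply/funext => N; rewrite opprB.
  by apply: cvgN; exact: W.
apply: (@squeeze_cvgr _ _ _ _ (fun=> 0) (fun N => q ^+ N / (1 - q) * (z - y))).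
- near=> N.
  have N0 : (0 < N)%N by near: N; exact: nbhs_infty_gt.
  have yN : 0 < y + N%:R by rewrite ltr_wpDr.
  have yzN : y + N%:R <= z + N%:R by rewrite lerD2r.
  have [c /andP[yc _]] := MVT_pos (is_derive_qlog_prim q_gt0 q_lt1) yN yzN.
  have -> : z + N%:R - (y + N%:R) = z - y by ring.
  move=> e; rewrite -[qlog_prim q _ - _]opprB e -mulNr.
  have c0 : 0 < c by exact: lt_le_trans yc.
  rewrite mulr_ge0 ?oppr_ge0 ?subr_ge0 ?qlog_le0//=.
  rewrite ler_wpM2r ?subr_ge0// lerNl qlog_ge_geometric//.
  by apply: le_trans yc; rewrite lerDr ltW.
- exact: cvg_cst.
- rewrite -[X in _ --> X](mul0r (z - y)); apply: cvgMr_tmp; exact: cvg_geometric_div.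
Unshelve. all: by end_near. Qed.
End qlog_bounds.

(** * The q-gamma function as a limit of telescoping sums *)

(** Logarithm of the [N]-th partial product in the definition of
    [qGamma q (y + 1)]. *)
Definition ln_qpoch_ratio {R : realType} (q : R) (N : nat) (y : R) : R :=
  \sum_(0 <= j < N) (qlog q j.+1%:R - qlog q (y + j.+1%:R)).

Section lngamma.
Context {R : realType} (q : R) (q_gt0 : 0 < q) (q_lt1 : q < 1).

Lemma ln_qpoch_ratio_prod (N : nat) (y : R) : 0 < y ->
  \prod_(0 <= j < N) ((1 - q ^+ j.+1) / (1 - q `^ (j%:R + (y + 1)))) =
  expR (ln_qpoch_ratio q N y).
Proof.
move=> y0; rewrite /ln_qpoch_ratio expR_sum; apply: eq_bigr => j _.
rewrite expRB -powR_mulrn ?(ltW q_gt0)//.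
have -> : j%:R + (y + 1) = y + j.+1%:R by rewrite -natr1; ring.
have lt1 (t : R) : 0 < t -> q `^ t < 1.
  by move=> /(powR_itv01 q_gt0 q_lt1)/andP[].
by rewrite !lnK// posrE subr_gt0 lt1// addr_gt0.
Qed.

(** Every term is nonpositive because [qlog] increases, and the geometric bound
    keeps the sums bounded below.  Working with logarithms also shows that the
    infinite product does not vanish. *)
Lemma is_cvg_ln_qpoch_ratio (y : R) : 0 < y -> cvgn (fun N => ln_qpoch_ratio q N y).
Proof.
move=> y0; apply: nonincreasing_is_cvgn.
  apply/nonincreasing_seqP => N; rewrite /ln_qpoch_ratio big_nat_recr//= gerDl subr_le0.
  by apply: qlog_nondecreasing; rewrite ?ltr0n// lerDr ltW.
exists (- (q / (1 - q) / (1 - q))) => _ [N _ <-].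
have q1 : 0 < 1 - q by rewrite subr_gt0.
have : - (q / (1 - q) / (1 - q)) <= - \sum_(0 <= j < N) (q ^+ j.+1 / (1 - q)).
  rewrite lerN2 -mulr_suml ler_pM2r ?invr_gt0//.
  have -> : \sum_(0 <= j < N) q ^+ j.+1 = q * (1 - q ^+ N) / (1 - q).
    elim: N => [|N IH]; first by rewrite big_nil expr0 subrr mulr0 mul0r.
    by rewrite big_nat_recr//= IH exprS; field; rewrite gt_eqF.
  rewrite ler_pM2r ?invr_gt0// ger_pMr// gerBl exprn_ge0//; exact: ltW.
move=> /le_trans; apply; rewrite -sumrN; apply: ler_sum => j _.
have := @qlog_ge_geometric _ q q_gt0 q_lt1 j.+1 j.+1%:R isT (lexx _).
have := @qlog_le0 _ q q_gt0 q_lt1 (y + j.+1%:R).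
rewrite ltr_wpDr// => /(_ isT); lra.
Qed.

Definition lnqGamma1 (y : R) : R :=
  limn (fun N => ln_qpoch_ratio q N y) - y * ln (1 - q).

Lemma qGammaE (y : R) : 0 < y -> qGamma q (y + 1) = expR (lnqGamma1 y).
Proof.
move=> y0; rewrite /qGamma /lnqGamma1.
have -> : (1 - q) `^ (1 - (y + 1)) = expR (- (y * ln (1 - q))).
  by rewrite /powR gt_eqF ?subr_gt0//; congr expR; ring.
rewrite [in RHS]addrC expRD; congr (_ * _).
apply/cvg_lim => //.
rewrite (_ : (fun N => _) = expR \o (fun N => ln_qpoch_ratio q N y)); last first.
  by apply/funext => N /=; rewrite ln_qpoch_ratio_prod.
apply: continuous_cvg; first exact: continuous_expR.
exact: is_cvg_ln_qpoch_ratio.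
Qed.

Context {n : nat} (p x : 'I_n -> R).
Context (x_gt0 : forall k, 0 < x k) (p_ge0 : forall k, 0 <= p k)
        (p_sum1 : \sum_(k < n) p k = 1).
Local Notation s := (\sum_(k < n) p k * x k).
Local Notation gap := (jensen_gap p x).

(** The shift [c] is the index at which the error enters the telescoping sum;
    it keeps the arguments positive, so concavity of the error applies. *)
Lemma jensen_gap_right_endpoint (c : R) : 0 <= c ->
  0 <= gap (fun y => qlog_prim q (y + c + 1) - qlog_prim q (y + c) - qlog q (y + c + 1)).
Proof.
move=> c0; rewrite -oppr_le0 -jensen_gapN.
pose f' y := - (qlog q (y + c + 1) - qlog q (y + c) - dqlog q (y + c + 1)).
pose f'' y := - (dqlog q (y + c + 1) - dqlog q (y + c) - d2qlog q (y + c + 1)).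
apply: (@jensen_gap_le0 _ _ _ _ x_gt0 p_ge0 p_sum1 _ f' f'') => y y0.
- have y1 : 0 < y + c by rewrite ltr_wpDr.
  have y2 : 0 < y + c + 1 by rewrite addr_gt0.
  have d1 := is_derive_add_arg (is_derive_qlog_prim q_gt0 q_lt1 y1).
  have d2 := is_derive_add_arg (is_derive_add_arg (is_derive_qlog_prim q_gt0 q_lt1 y2)).
  have d3 := is_derive_add_arg (is_derive_add_arg (is_derive_qlog q_gt0 q_lt1 y2)).
  exact: is_deriveN (is_deriveB (is_deriveB d2 d1) d3).
- have y1 : 0 < y + c by rewrite ltr_wpDr.
  have y2 : 0 < y + c + 1 by rewrite addr_gt0.
  have d1 := is_derive_add_arg (is_derive_qlog q_gt0 q_lt1 y1).
  have d2 := is_derive_add_arg (is_derive_add_arg (is_derive_qlog q_gt0 q_lt1 y2)).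
  have d3 := is_derive_add_arg (is_derive_add_arg (is_derive_dqlog q_gt0 q_lt1 y2)).
  exact: is_deriveN (is_deriveB (is_deriveB d2 d1) d3).
- by rewrite /f'' oppr_ge0 subr_le0 dqlog_increment_le// ltr_wpDr.
Qed.

Lemma jensen_gap_trapezoid (c : R) : 0 <= c ->
  gap (fun y => qlog_prim q (y + c + 1) - qlog_prim q (y + c) -
                2^-1 * (qlog q (y + c) + qlog q (y + c + 1))) <= 0.
Proof.
move=> c0.
pose f' y := qlog q (y + c + 1) - qlog q (y + c) -
  2^-1 * (dqlog q (y + c) + dqlog q (y + c + 1)).
pose f'' y := dqlog q (y + c + 1) - dqlog q (y + c) -
  2^-1 * (d2qlog q (y + c) + d2qlog q (y + c + 1)).
apply: (@jensen_gap_le0 _ _ _ _ x_gt0 p_ge0 p_sum1 _ f' f'') => y y0.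
- have y1 : 0 < y + c by rewrite ltr_wpDr.
  have y2 : 0 < y + c + 1 by rewrite addr_gt0.
  have d1 := is_derive_add_arg (is_derive_qlog_prim q_gt0 q_lt1 y1).
  have d2 := is_derive_add_arg (is_derive_add_arg (is_derive_qlog_prim q_gt0 q_lt1 y2)).
  have d3 := is_derive_add_arg (is_derive_add_arg (is_derive_qlog q_gt0 q_lt1 y2)).
  have d4 := is_derive_add_arg (is_derive_qlog q_gt0 q_lt1 y1).
  exact: is_deriveB (is_deriveB d2 d1) (is_deriveZ 2^-1 (is_deriveD d4 d3)).
- have y1 : 0 < y + c by rewrite ltr_wpDr.
  have y2 : 0 < y + c + 1 by rewrite addr_gt0.
  have d1 := is_derive_add_arg (is_derive_qlog q_gt0 q_lt1 y1).
  have d2 := is_derive_add_arg (is_derive_add_arg (is_derive_qlog q_gt0 q_lt1 y2)).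
  have d3 := is_derive_add_arg (is_derive_add_arg (is_derive_dqlog q_gt0 q_lt1 y2)).
  have d4 := is_derive_add_arg (is_derive_dqlog q_gt0 q_lt1 y1).
  exact: is_deriveB (is_deriveB d2 d1) (is_deriveZ 2^-1 (is_deriveD d4 d3)).
- by rewrite /f'' subr_ge0 mulrC dqlog_increment_ge// ltr_wpDr.
Qed.

Lemma jensen_gap_ln_qpoch_ratioS (N : nat) :
  gap (ln_qpoch_ratio q N.+1) =
  gap (ln_qpoch_ratio q N) - gap (fun y => qlog q (y + N%:R + 1)).
Proof.
transitivity (gap (fun y => ln_qpoch_ratio q N y +
  (qlog q N.+1%:R + - qlog q (y + N%:R + 1)))).
  congr jensen_gap; apply/funext => y.
  by rewrite /ln_qpoch_ratio big_nat_recr//= -(addrA y) natr1.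
by rewrite jensen_gapD jensen_gapD jensen_gap_cst// add0r jensen_gapN.
Qed.

(** Sum of the right-endpoint inequalities for the shifts [0, ..., N - 1]. *)
Lemma jensen_gap_ln_qpoch_ratio_ge (N : nat) :
  gap (qlog_prim q) - gap (fun y => qlog_prim q (y + N%:R)) <=
  gap (ln_qpoch_ratio q N).
Proof.
have step (a b b' c P : R) : 0 <= b' - b - c -> a - b <= P -> a - b' <= P - c.
  by lra.
elim: N => [|N IH].
  rewrite (_ : (fun y => _) = qlog_prim q); last by apply/funext => y; rewrite addr0.
  rewrite subrr (_ : ln_qpoch_ratio q 0 = fun=> 0) ?jensen_gap_cst//.
  by apply/funext => y; rewrite /ln_qpoch_ratio big_nil.
have := jensen_gap_right_endpoint (ler0n R N).
rewrite jensen_gapD jensen_gapD !jensen_gapN jensen_gap_ln_qpoch_ratioS.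
rewrite [X in _ - jensen_gap p x X <= _](_ : _ =
  fun y => qlog_prim q (y + N%:R + 1)); last first.
  by apply/funext => y; rewrite -natr1 addrA.
by move=> /step; exact.
Qed.

(** Sum of the trapezoid inequalities; replacing [qlog q (y + j + 1)] by its
    average with [qlog q (y + j)] costs a second telescoping sum. *)
Lemma jensen_gap_ln_qpoch_ratio_le (N : nat) :
  gap (ln_qpoch_ratio q N) <=
  gap (qlog_prim q) - gap (fun y => qlog_prim q (y + N%:R)) +
  2^-1 * (gap (qlog q) - gap (fun y => qlog q (y + N%:R))).
Proof.
have step (a b b' c d d' P : R) : b' - b - 2^-1 * (d + d') <= 0 ->
  P <= a - b + 2^-1 * (c - d) -> P - d' <= a - b' + 2^-1 * (c - d').
  by lra.
elim: N => [|N IH].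
  rewrite (_ : (fun y => _) = qlog_prim q); last by apply/funext => y; rewrite addr0.
  rewrite (_ : (fun y => _) = qlog q); last by apply/funext => y; rewrite addr0.
  rewrite !subrr mulr0 addr0 (_ : ln_qpoch_ratio q 0 = fun=> 0) ?jensen_gap_cst//.
  by apply/funext => y; rewrite /ln_qpoch_ratio big_nil.
have := jensen_gap_trapezoid (ler0n R N).
rewrite jensen_gapD jensen_gapD !jensen_gapN jensen_gapZ jensen_gapD.
rewrite jensen_gap_ln_qpoch_ratioS.
rewrite [X in _ <= _ - jensen_gap p x X + _](_ : _ =
  fun y => qlog_prim q (y + N%:R + 1)); last first.
  by apply/funext => y; rewrite -natr1 addrA.
rewrite [X in _ <= _ + _ * (_ - jensen_gap p x X)](_ : _ =
  fun y => qlog q (y + N%:R + 1)); last first.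
  by apply/funext => y; rewrite -natr1 addrA.
by move=> /step; exact.
Qed.

Let cvg_gap_qlog_prim : gap (fun y => qlog_prim q (y + N%:R)) @[N --> \oo] --> (0 : R).
Proof.
apply: (jensen_gap_cvg0 x_gt0 p_ge0 p_sum1 (u := fun N y => qlog_prim q (y + N%:R))).
exact: cvg_qlog_prim_shift.
Qed.

Let cvg_gap_qlog : gap (fun y => qlog q (y + N%:R)) @[N --> \oo] --> (0 : R).
Proof.
apply: (jensen_gap_cvg0 x_gt0 p_ge0 p_sum1 (u := fun N y => qlog q (y + N%:R))).
move=> y z y0 z0; rewrite -[X in _ --> X](subrr 0).
by apply: cvgB; exact: cvg_qlog_shift.
Qed.

Let cvg_gap_poch : gap (ln_qpoch_ratio q N) @[N --> \oo] -->
  gap (fun y => limn (fun N => ln_qpoch_ratio q N y)).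
Proof.
apply: (jensen_gap_cvg x_gt0 p_ge0 p_sum1) => y y0; exact: is_cvg_ln_qpoch_ratio.
Qed.

Lemma jensen_gap_lim_ln_qpoch_ratio :
  gap (qlog_prim q) <= gap (fun y => limn (fun N => ln_qpoch_ratio q N y)) <=
  gap (qlog_prim q) + 2^-1 * gap (qlog q).
Proof.
apply/andP; split.
- rewrite -[leLHS]subr0; apply: (ler_cvg_to _ cvg_gap_poch).
    by apply: cvgB; [exact: cvg_cst|exact: cvg_gap_qlog_prim].
  by apply: nearW => N; exact: jensen_gap_ln_qpoch_ratio_ge.
- rewrite -[X in X + _]subr0 -[X in _ * X]subr0.
  apply: (ler_cvg_to cvg_gap_poch); last first.
    by apply: nearW => N; exact: jensen_gap_ln_qpoch_ratio_le.
  apply: cvgD; first by apply: cvgB; [exact: cvg_cst|exact: cvg_gap_qlog_prim].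
  apply: cvgMl_tmp.
  by apply: cvgB; [exact: cvg_cst|exact: cvg_gap_qlog].
Qed.

(** The factor [(1 - q)^(- y)] of [qGamma q (y + 1)] is the exponential of a
    linear function of [y]. *)
Lemma jensen_gap_lnqGamma1 :
  gap lnqGamma1 = gap (fun y => limn (fun N => ln_qpoch_ratio q N y)).
Proof.
transitivity (gap (fun y => limn (fun N => ln_qpoch_ratio q N y) +
                            (- ln (1 - q) * y + 0))).
  by congr jensen_gap; apply/funext => y; rewrite /lnqGamma1 addr0 mulNr mulrC.
by rewrite jensen_gapD jensen_gap_affine// addr0.
Qed.

Lemma qnumberE (y t : R) : 0 < y ->
  ((1 - q `^ y) / (1 - q)) `^ t = expR (t * (qlog q y - ln (1 - q))).
Proof.
move=> /(powR_itv01 q_gt0 q_lt1)/andP[_ z1].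
by rewrite [t * _]mulrC expRM /qlog expRB !lnK// posrE subr_gt0//.
Qed.

(** Common form of the two bounds, with [t = 0] for the lower and [t = 1/2] for
    the upper one.  The dilogarithm completes [y * qlog q y] to [qlog_prim], and
    the terms in [ln (1 - q)] form an affine function. *)
Lemma qnumber_ratioE (t : R) :
  ((1 - q `^ s) / (1 - q)) `^ (s + t)
    / (\prod_(k < n) ((1 - q `^ x k) / (1 - q)) `^ (p k * (x k + t)))
    * expR ((Li2 (1 - q `^ s) - \sum_(k < n) p k * Li2 (1 - q `^ x k)) / ln q) =
  expR (gap (qlog_prim q) + t * gap (qlog q)).
Proof.
pose f y := (y + t) * (qlog q y - ln (1 - q)).
have -> : ((1 - q `^ s) / (1 - q)) `^ (s + t) /
    (\prod_(k < n) ((1 - q `^ x k) / (1 - q)) `^ (p k * (x k + t))) = expR (gap f).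
  rewrite expR_jensen_gap qnumberE; last exact: wmean_gt0.
  congr (_ / _); apply: eq_bigr => k _.
  by rewrite [p k * _]mulrC powRrM qnumberE.
rewrite -expRD; congr expR.
rewrite -[X in _ + X]/(gap (fun y => Li2 (1 - q `^ y)) / ln q) mulrC.
rewrite -jensen_gapZ -jensen_gapD -jensen_gapZ -jensen_gapD.
transitivity (gap (fun y => qlog_prim q y + t * qlog q y +
  (- ln (1 - q) * y + - (t * ln (1 - q))))).
  by congr jensen_gap; apply/funext => y; rewrite /f /qlog_prim; ring.
by rewrite jensen_gapD jensen_gap_affine// addr0 jensen_gapD jensen_gapZ.
Qed.
End lngamma.

Theorem corollary2 (R : realType) (q : R) (n : nat) (x p : 'I_n -> R)
    (q_gt0 : 0 < q) (q_lt1 : q < 1) (n_ge1 : (1 <= n)%N)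
    (x_gt0 : forall k, 0 < x k) (p_ge0 : forall k, 0 <= p k)
    (p_sum1 : \sum_(k < n) p k = 1) :
  let s := \sum_(k < n) p k * x k in
  let E := expR ((Li2 (1 - q `^ s) - \sum_(k < n) p k * Li2 (1 - q `^ x k))
                 / ln q) in
  let ratio := qGamma q (s + 1) / \prod_(k < n) qGamma q (x k + 1) `^ p k in
  ((1 - q `^ s) / (1 - q)) `^ s
    / (\prod_(k < n) ((1 - q `^ x k) / (1 - q)) `^ (p k * x k)) * E
  <= ratio /\
  ratio <=
  ((1 - q `^ s) / (1 - q)) `^ (s + 1 / 2)
    / (\prod_(k < n) ((1 - q `^ x k) / (1 - q)) `^ (p k * (x k + 1 / 2))) * E.
Proof.
move=> s E ratio.
have s0 : 0 < s by exact: wmean_gt0.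
have ratioE : ratio = expR (jensen_gap p x (lnqGamma1 q)).
  rewrite /ratio expR_jensen_gap (qGammaE q_gt0 q_lt1 s0); congr (_ / _).
  by apply: eq_bigr => k _; rewrite qGammaE.
have /andP[lo hi] :=
  jensen_gap_lim_ln_qpoch_ratio q_gt0 q_lt1 x_gt0 p_ge0 p_sum1.
split.
- have := qnumber_ratioE q_gt0 q_lt1 x_gt0 p_ge0 p_sum1 0.
  rewrite addr0 mul0r addr0; under [X in _ / X * _]eq_bigr do rewrite addr0.
  by move=> e; rewrite [leLHS]e ratioE ler_expR jensen_gap_lnqGamma1.
- have e := qnumber_ratioE q_gt0 q_lt1 x_gt0 p_ge0 p_sum1 (1 / 2).
  by rewrite [leRHS]e ratioE ler_expR jensen_gap_lnqGamma1// mul1r.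
Qed.
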